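(* Let $G$ be a finitely generated amenable group admitting a controlled Følner sequence. Let $\pi: G\to\mathscr{O}(\mathcal{H})$ be an orthogonal representation, and let $b: G\to\mathcal{H}$ be a $1$-cocycle associated to $\pi$. Suppose that $$\int \frac{1}{|g|}\langle b(g^{-1}),\xi\rangle\, d\mu_n(g)\to 0$$ for all $\xi\in\mathcal{H}$ and all Reiter sequences $(\mu_n)$ for $G$. Then the affine action $G\curvearrowright^T\mathcal{H}$ associated to $b$, $T_g(\xi)=\pi_g(\xi)+b(g)$, admits a sequence of almost fixed points.
   Context: $G$ is a countable discrete group with a fixed finite symmetric generating set $S$ and word length $|\cdot|$ in $S$; $B(m)=\{g\in G: |g|\le m\}$; $\mathcal{H}$ is a (real) Hilbert space and $\mathscr{O}(\mathcal{H})$ its orthogonal group. By convention $\frac{1}{|e|}$ denotes $0$ for $e$ the identity. A $1$-cocycle associated to $\pi$ is a map $b: G\to\mathcal{H}$ with $b(gh)=\pi_g(b(h))+b(g)$ for all $g,h\in G$. An isometric action $T$ of $G$ on $\mathcal{H}$ admits (a sequence of) almost fixed points if there is a sequence $(\xi_n)$ in $\mathcal{H}$ with $\|T_g(\xi_n)-\xi_n\|\to 0$ for all $g\in G$. A Reiter sequence for $G$ is a sequence $(\mu_n)$ of probability measures on $G$ with $\|\mu_n-g\ast\mu_n\|\to 0$ ($\ell^1$ norm) for all $g\in G$, where $g\ast\mu_n(h)=\mu_n(g^{-1}h)$; $G$ is amenable if it admits a Reiter sequence. A sequence $(F_n)$ of finite subsets of $G$ is a Følner sequence if $|gF_n\Delta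 F_n|/|F_n|\to 0$ for all $g\in G$. For finite $F\subset G$ put $\partial F=\bigcup_{g\in S} gF\Delta F$, and let $\operatorname{diam} F$ be the least integer $m$ such that $F\subset B(m)$. For $K>0$, a Følner sequence $(F_n)$ is $K$-controlled if $\frac{|\partial F_n|}{|F_n|}\le\frac{K}{\operatorname{diam} F_n}$ for all $n$. $G$ admits a controlled Følner sequence if it admits a $K$-controlled Følner sequence for some $K$. *)

(* Defs.v *)
From HB Require Import structures.
From mathcomp Require Import all_boot all_order all_algebra.
From mathcomp Require Import finmap.
From mathcomp Require Import all_classical all_reals all_analysis.

Set Implicit Arguments.
Unset Strict Implicit.
Unset Printing Implicit Defensive.

Import Order.TTheory GRing.Theory Num.Theory.
Import numFieldNormedType.Exports.

Local Open Scope classical_set_scope.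
Local Open Scope ring_scope.

Definition symmetric_gen (G : groupType) (S : {fset G}) : Prop :=
  forall x, x \in S -> (x^-1)%g \in S.

(* For symmetric [S], the submonoid generated by [S] is the subgroup generated
   by [S], so words without inverses suffice. *)
Definition is_word (G : groupType) (S : {fset G}) (g : G) (s : seq G) : Prop :=
  {subset s <= S} /\ (\prod_(x <- s) x)%g = g.

Definition generates (G : groupType) (S : {fset G}) : Prop :=
  forall g, exists s, is_word S g s.

(* The least element of [P]; 0 if [P] is empty. *)
Definition least (P : set nat) : nat :=
  xget 0%N [set m | P m /\ forall k, P k -> (m <= k)%N].

Definition wlen (G : groupType) (S : {fset G}) (g : G) : nat :=
  least [set n | exists2 s, is_word S g s & size s = n].

Definition wball (G : groupType) (S : {fset G}) (m : nat) : set G :=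
  [set g | (wlen S g <= m)%N].

Definition ltransl (G : groupType) (g : G) (F : {fset G}) : {fset G} :=
  [fset (g * x)%g | x in F]%fset.

Definition fsymdiff (G : groupType) (A B : {fset G}) : {fset G} :=
  ((A `\` B) `|` (B `\` A))%fset.

Definition boundary (G : groupType) (S F : {fset G}) : {fset G} :=
  (\bigcup_(g <- S) fsymdiff (ltransl g F) F)%fset.

Definition diam (G : groupType) (S F : {fset G}) : nat :=
  least [set m | [set` F] `<=` wball S m].

Definition folner (R : realType) (G : groupType) (F : nat -> {fset G}) : Prop :=
  (forall n, F n != fset0) /\
  forall g : G,
    (#|` fsymdiff (ltransl g (F n)) (F n)|%:R / #|` F n|%:R : R)
      @[n --> \oo] --> (0 : R).

(* When [diam S (F n) = 0], that is [F n = [fset 1]], the bound [K / 0] is read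
   as [+oo] and imposes nothing. *)
Definition controlled_folner (R : realType) (G : groupType) (S : {fset G})
    (K : R) (F : nat -> {fset G}) : Prop :=
  folner R F /\
  forall n, (0 < diam S (F n))%N ->
    #|` boundary S (F n)|%:R / #|` F n|%:R <= K / (diam S (F n))%:R.

Definition admits_controlled_folner (R : realType) (G : groupType)
    (S : {fset G}) : Prop :=
  exists2 K : R, 0 < K & exists F, controlled_folner S K F.

(* [G] with the sigma-algebra of all its subsets. *)
Definition discrete (G : groupType) : Type := G.

HB.instance Definition _ (G : groupType) := Choice.on (discrete G).
HB.instance Definition _ (G : groupType) :=
  isPointed.Build (discrete G) (1%g : G).
HB.instance Definition _ (G : groupType) :=
  @isMeasurable.Build default_measure_display (discrete G)
    discrete_measurable discrete_measurable0
    discrete_measurableC discrete_measurableU.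

Definition reiter (R : realType) (G : groupType)
    (mu : nat -> probability (discrete G) R) : Prop :=
  forall g : G,
    (\esum_(h in [set: G]) `|mu n [set h] - mu n [set (g^-1 * h)%g]|)%E
      @[n --> \oo] --> (0 : \bar R)%E.

Definition amenable (R : realType) (G : groupType) : Prop :=
  exists mu : nat -> probability (discrete G) R, reiter mu.

(* [H] is complete, so this makes it a real Hilbert space. *)
Definition hilbert_dot (R : realType) (H : completeNormedModType R)
    (dot : {dot H for idfun}) : Prop :=
  forall x, dot x x = `|x| ^+ 2.

Definition orthogonal_operator (R : realType) (H : completeNormedModType R)
    (dot : {dot H for idfun}) (u : H -> H) : Prop :=
  [/\ linear u, bijective u & isometry dot dot u].

Definition orthogonal_rep (R : realType) (G : groupType)
    (H : completeNormedModType R) (dot : {dot H for idfun})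
    (pi : G -> H -> H) : Prop :=
  (forall g, orthogonal_operator dot (pi g)) /\
  forall g h, pi (g * h)%g = pi g \o pi h.

Definition cocycle (R : realType) (G : groupType) (H : completeNormedModType R)
    (pi : G -> H -> H) (b : G -> H) : Prop :=
  forall g h, b (g * h)%g = pi g (b h) + b g.

Definition affine_action (R : realType) (G : groupType)
    (H : completeNormedModType R) (pi : G -> H -> H) (b : G -> H)
    (g : G) (x : H) : H :=
  pi g x + b g.

Definition almost_fixed_points (R : realType) (G : groupType)
    (H : completeNormedModType R) (T : G -> H -> H) : Prop :=
  exists xi : nat -> H,
    forall g, `|T g (xi n) - xi n| @[n --> \oo] --> (0 : R).

(* Main.v *)
(* Right translates of a Reiter sequence are again Reiter.  Applied to the
   uniform measures on F_n x_n^-1 with |x_n| much larger than diam F_n, the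
   hypothesis therefore says that <b(x), xi> / |x| tends to 0 as |x| goes to
   infinity.  If xi_n is the average of b over a controlled Folner set F_n, then
   T_s xi_n - xi_n is, up to signs, 1/|F_n| times the sum of b over the
   symmetric difference of s F_n and F_n.  The control makes it bounded in norm, and the
   sublinearity of <b, xi> makes it weakly null; convex combinations of the xi_n
   are then almost fixed by the generators, hence by G. *)
Require Import Defs.
From HB Require Import structures.
From mathcomp Require Import all_boot all_order all_algebra.
From mathcomp Require Import finmap.
From mathcomp Require Import all_classical all_reals all_analysis.
From mathcomp Require Import ring lra.

Set Implicit Arguments.
Unset Strict Implicit.
Unset Printing Implicit Defensive.

Import Order.TTheory GRing.Theory Num.Theory.
Import numFieldNormedType.Exports.

Local Open Scope classical_set_scope.
Local Open Scope ring_scope.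

(** * Word length in a symmetric generating set *)

Lemma leastP (P : set nat) k : P k -> P (least P).
Proof.
move=> Pk; rewrite /least.
have exP : exists n, `[< P n >] by exists k; exact/asboolP.
case: xgetP => [m _ [] //|/(_ (ex_minn exP)) []].
by case: ex_minnP => m /asboolP Pm mP; split=> // j /asboolP /mP.
Qed.

Lemma least_le (P : set nat) k : P k -> (least P <= k)%N.
Proof.
move=> Pk; rewrite /least.
have exP : exists n, `[< P n >] by exists k; exact/asboolP.
case: xgetP => [m _ [_] /(_ _ Pk) //|/(_ (ex_minn exP)) []].
by case: ex_minnP => m /asboolP Pm mP; split=> // j /asboolP /mP.
Qed.

Section WordLength.
Variables (G : groupType) (S : {fset G}).
Hypotheses (Ssym : symmetric_gen S) (Sgen : generates S).

Lemma wlen_word g : exists2 s, is_word S g s & size s = wlen S g.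
Proof.
have [s gs] := Sgen g.
apply: (@leastP [set n | exists2 s, is_word S g s & size s = n] (size s)).
by exists s.
Qed.

Lemma wlen_le g s : is_word S g s -> (wlen S g <= size s)%N.
Proof. by move=> gs; apply: least_le; exists s. Qed.

Lemma wlenM g h : (wlen S (g * h)%g <= wlen S g + wlen S h)%N.
Proof.
have [[s [sS sg] <-] [t [tS th] <-]] := (wlen_word g, wlen_word h).
rewrite -size_cat; apply: wlen_le; split; last by rewrite big_cat /= sg th.
by move=> x; rewrite mem_cat => /orP[/sS|/tS].
Qed.

Lemma wlen_gen s : s \in S -> (wlen S s <= 1)%N.
Proof.
move=> sS; apply: (@wlen_le s [:: s]).
by split; [move=> x; rewrite inE => /eqP->|rewrite big_seq1].
Qed.

Lemma is_wordV g s : is_word S g s ->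
  is_word S (g^-1)%g (rev [seq (x^-1)%g | x <- s]).
Proof.
elim: s g => [|x s IHs] g [sS <-]; first by
  rewrite big_nil invg1; split; rewrite /= ?big_nil.
have xS : x \in S by apply: sS; rewrite mem_head.
have [|tS tE] := IHs (\prod_(y <- s) y)%g.
  by split=> // y ys; apply: sS; rewrite inE ys orbT.
split=> [y|].
  by rewrite /= rev_cons mem_rcons inE => /orP[/eqP->|/tS//]; exact: Ssym.
by rewrite /= rev_cons -cats1 big_cat /= tE big_seq1 big_cons invgM.
Qed.

Lemma wlenV g : (wlen S (g^-1)%g <= wlen S g)%N.
Proof.
have [s gs <-] := wlen_word g.
by apply: leq_trans (wlen_le (is_wordV gs)) _; rewrite size_rev size_map.
Qed.

Lemma wlen_diam (F : {fset G}) g : g \in F -> (wlen S g <= diam S F)%N.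
Proof.
suff : [set` F] `<=` wball S (diam S F) by move=> + gF; apply.
apply: (@leastP [set m | [set` F] `<=` wball S m]
  (\max_(x <- F) wlen S x)) => x /= xF.
by rewrite /wball /= (big_fsetD1 x) //= leq_maxl.
Qed.

End WordLength.

(** * Translates and symmetric differences of finite sets *)

Lemma ltranslP (G : groupType) (g : G) (F : {fset G}) h :
  (h \in ltransl g F) = ((g^-1 * h)%g \in F).
Proof.
apply/imfsetP/idP => [[y /= yF ->]|hF]; first by rewrite mulKg.
by exists (g^-1 * h)%g => //; rewrite mulVKg.
Qed.

Lemma fsymdiffP (G : groupType) (A B : {fset G}) h :
  (h \in fsymdiff A B) = ((h \in A) (+) (h \in B)).
Proof. by rewrite !inE; case: (h \in A); case: (h \in B). Qed.

Definition rtransl (G : groupType) (F : {fset G}) (x : G) : {fset G} :=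
  [fset (y * x)%g | y in F]%fset.

Lemma rtranslP (G : groupType) (F : {fset G}) (x : G) h :
  (h \in rtransl F x) = ((h * x^-1)%g \in F).
Proof.
apply/imfsetP/idP => [[y /= yF ->]|hF]; first by rewrite mulgK.
by exists (h * x^-1)%g => //; rewrite mulgVK.
Qed.

Lemma card_rtransl (G : groupType) (F : {fset G}) (x : G) :
  #|` rtransl F x| = #|` F|.
Proof. by rewrite card_imfset //=; exact: mulIg. Qed.

(** Left and right translations commute, so right translation preserves Følner ratios. *)
Lemma fsymdiff_rtransl (G : groupType) (g x : G) (F : {fset G}) :
  fsymdiff (ltransl g (rtransl F x)) (rtransl F x) =
  rtransl (fsymdiff (ltransl g F) F) x.
Proof.
by apply/fsetP => h; rewrite !(fsymdiffP, rtranslP, ltranslP) mulgA.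
Qed.

(** * Uniform measures and Reiter sequences *)

Section Uniform.
Variables (R : realType) (G : groupType).

(** The Dirac mass is the fallback of [mnormalize] for total mass zero, which occurs only for empty
    [F]. *)
Definition unif (F : {fset G}) : probability (discrete G) R :=
  mnormalize
    (mrestr (@counting (discrete G) R)
       (I : measurable ([set` F] : set (discrete G))))
    (dirac (1%g : discrete G)).

Lemma unifE (F : {fset G}) (A : {fset G}) : F != fset0 -> {subset A <= F} ->
  unif F [set` A] = (#|` A|%:R / #|` F|%:R)%:E.
Proof.
move=> F0 AF; rewrite /unif /= /mnormalize /= /mrestr /counting setTI.
rewrite asboolT //= set_fsetK eqe pnatr_eq0 cardfs_eq0 (negbTE F0) /=.
rewrite setIidl; last by move=> x /AF.
by rewrite asboolT //= set_fsetK EFinM.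
Qed.

Lemma unif0 (F : {fset G}) (A : set (discrete G)) : F != fset0 ->
  A `&` [set` F] = set0 -> unif F A = 0%E.
Proof.
move=> F0 AF; rewrite /unif /= /mnormalize /= /mrestr /counting setTI.
rewrite asboolT //= set_fsetK eqe pnatr_eq0 cardfs_eq0 (negbTE F0) /=.
by rewrite AF asboolT //= fset_set0 cardfs0 mul0e.
Qed.

Lemma unif_set1 (F : {fset G}) (h : G) : F != fset0 ->
  unif F [set (h : discrete G)] = ((h \in F)%:R / #|` F|%:R)%:E.
Proof.
move=> F0; have [hF|hF] := boolP (h \in F).
  rewrite [nat_of_bool _]/= (esym (cardfs1 h)) -unifE // => [|x]; last first.
    by rewrite inE => /eqP->.
  by congr (unif F _); apply/seteqP; split=> x /=; rewrite inE => /eqP.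
by rewrite mul0r unif0 // -subset0 => _ [-> hF']; rewrite hF' in hF.
Qed.

(** The two densities differ exactly on the symmetric difference, by [1/|F|] at each point. *)
Lemma esum_unif_ltransl (F : {fset G}) (g : G) : F != fset0 ->
  (\esum_(h in [set: G])
     `|unif F [set h] - unif F [set (g^-1 * h)%g]| =
   (#|` fsymdiff (ltransl g F) F|%:R / #|` F|%:R)%:E)%E.
Proof.
move=> F0; pose D := fsymdiff (ltransl g F) F.
transitivity (\esum_(h in [set: G]) if h \in [set` D] then
    ((#|` F|%:R)^-1 : R)%:E else 0)%E.
  apply: eq_esum => h _; rewrite !unif_set1 // mem_setE /D fsymdiffP ltranslP.
  rewrite -EFinB abse_EFin -mulrBl normrM [X in _ * X]ger0_norm ?invr_ge0 //.
  case: (h \in F); case: (_ \in F);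
    by rewrite /= ?subrr ?subr0 ?sub0r ?normrN ?normr0 ?normr1 ?mul0r ?mul1r.
rewrite -esum_mkcond esum_fset //.
rewrite fsbig_finite //= set_fsetK sumEFin big_const_seq count_predT.
by rewrite iter_addr_0 mulr_natl.
Qed.

(** The translating elements [x n] are arbitrary: they can be sent to infinity as fast as desired
    without affecting the Reiter property. *)
Lemma reiter_unif_rtransl (F : nat -> {fset G}) (x : nat -> G) :
  folner R F -> reiter (fun n => unif (rtransl (F n) (x n))).
Proof.
move=> [F0 FF] g; rewrite (_ : (fun n => _) = fun n =>
    (#|` fsymdiff (ltransl g (F n)) (F n)|%:R / #|` F n|%:R : R)%:E).
  by apply: cvg_EFin; [exact: nearW|exact: FF].
apply/funext => n.
by rewrite esum_unif_ltransl ?fsymdiff_rtransl ?card_rtransl //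
  -cardfs_gt0 card_rtransl cardfs_gt0.
Qed.

Lemma unif_integral_ge (F : {fset G}) (f : G -> R) (c : R) : F != fset0 ->
  0 <= c -> (forall g, g \in F -> c <= f g) ->
  (c%:E <= \int[unif F]_(g in [set: discrete G]) (f g)%:E)%E.
Proof.
move=> F0 c0 cf.
(* Nothing is known about [f] on the complement of [F], which is null for [unif F]. The maximum with
   [c] agrees with [f] on [F] and is nonnegative everywhere, so monotonicity needs no
   integrability. *)
rewrite (@ae_eq_integral _ _ _ _ _
  (fun g : discrete G => (Num.max (f g) c)%:E)) //.
  apply: (@le_trans _ _ (\int[unif F]_(g in setT) (cst c%:E g))%E).
    by rewrite integral_cst // -[leLHS]mule1 -(probability_setT (unif F)).
  by apply: ge0_le_integral => // x _; rewrite lee_fin le_max lexx orbT.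
exists (~` [set` F]); split=> //; first exact/unif0/setICl.
by move=> g /= gf gF; apply: gf => _; rewrite max_l // cf.
Qed.

End Uniform.

(** * Sums over symmetric differences *)

Lemma sum_fset_filter (R : realType) (G : groupType) (V : normedModType R)
  (f : G -> V) (A U : {fset G}) : (A `<=` U)%fset ->
  \sum_(x <- A) f x = \sum_(x <- U) (if x \in A then f x else 0).
Proof.
move=> AU; rewrite -(big_fset_incl _ AU) => [|x _ /negbTE-> //].
by apply: eq_big_seq => x ->.
Qed.

(** With both sums extended by zero to the union, the terms in the intersection cancel. *)
Lemma normB_sum_fset (R : realType) (G : groupType) (V : normedModType R)
  (f : G -> V) (A B : {fset G}) :
  `|\sum_(x <- A) f x - \sum_(x <- B) f x| <=
  \sum_(x <- fsymdiff A B) `|f x|.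
Proof.
pose U := (A `|` B)%fset.
rewrite (@sum_fset_filter _ _ _ f A U) ?fsubsetUl //.
rewrite (@sum_fset_filter _ _ _ f B U) ?fsubsetUr //.
rewrite (@sum_fset_filter _ _ R^o _ _ U); last first.
  by apply/fsubsetP => x; rewrite fsymdiffP inE; case: (x \in A).
rewrite -sumrB; apply: le_trans (ler_norm_sum _ _ _) _.
apply: ler_sum => x _; rewrite fsymdiffP.
by case: (x \in A); case: (x \in B);
  rewrite /= ?subrr ?subr0 ?sub0r ?normrN ?normr0.
Qed.

Lemma norm_ltransl_avg (R : realType) (G : groupType) (V : normedModType R)
  (f : G -> V) (F : {fset G}) (s : G) (c : R) :
  (forall x, x \in fsymdiff (ltransl s F) F -> `|f x| <= c) ->
  `|(#|` F|%:R^-1 : R) *: (\sum_(x <- ltransl s F) f x - \sum_(x <- F) f x)| <=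
  #|` fsymdiff (ltransl s F) F|%:R / #|` F|%:R * c.
Proof.
move=> fc; rewrite normrZ ger0_norm ?invr_ge0 // mulrAC [leLHS]mulrC.
rewrite ler_wpM2r ?invr_ge0 //.
apply: le_trans (normB_sum_fset _ _ _) _; rewrite big_seq.
apply: le_trans (ler_sum _ fc) _; rewrite -big_seq big_const_seq count_predT.
by rewrite iter_addr_0 mulr_natl.
Qed.

(** * Norm and inner product *)

Section Hilbert.
Variables (R : realType) (H : completeNormedModType R).
Variable dot : {dot H for idfun}.
Hypothesis Hhilbert : hilbert_dot dot.

Lemma dotC x y : dot x y = dot y x.
Proof. by rewrite hermC expr0 mul1r. Qed.

Lemma sqr_normD x y : `|x + y| ^+ 2 = `|x| ^+ 2 + dot x y *+ 2 + `|y| ^+ 2.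
Proof.
rewrite -!Hhilbert linearDl !linearDr /= (dotC y x) mulr2n.
by rewrite !addrA.
Qed.

(** Cauchy-Schwarz is read off from the triangle inequality by expanding the square of [|u + y|]. *)
Lemma dot_le_norm x y : `|dot x y| <= `|x| * `|y|.
Proof.
suff dle u : dot u y <= `|u| * `|y|.
  by rewrite ler_norml dle andbT lerNl -linearNl -(normrN x) dle.
have : `|u + y| ^+ 2 <= (`|u| + `|y|) ^+ 2.
  by rewrite ler_sqr ?nnegrE ?addr_ge0 // ler_normD.
by rewrite sqr_normD sqrrD lerD2r lerD2l lerMn2r.
Qed.

End Hilbert.

(** * Orthogonal representations and the Lipschitz bound for cocycles *)

Section Cocycle.
Variables (R : realType) (G : groupType) (S : {fset G}).
Hypotheses (Ssym : symmetric_gen S) (Sgen : generates S).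
Variables (H : completeNormedModType R) (dot : {dot H for idfun}).
Hypothesis Hhilbert : hilbert_dot dot.
Variables (pi : G -> H -> H) (b : G -> H).
Hypotheses (pi_rep : orthogonal_rep dot pi) (b_cocycle : cocycle pi b).

Lemma repD g x y : pi g (x + y) = pi g x + pi g y.
Proof. by have [+ _ _] := pi_rep.1 g => /(_ 1 x y); rewrite !scale1r. Qed.

Lemma rep0 g : pi g 0 = 0.
Proof. by apply: (addrI (pi g 0)); rewrite -repD !addr0. Qed.

Lemma repZ g a x : pi g (a *: x) = a *: pi g x.
Proof.
by have [+ _ _] := pi_rep.1 g => /(_ a x 0); rewrite rep0 !addr0.
Qed.

Lemma repB g x y : pi g (x - y) = pi g x - pi g y.
Proof. by rewrite -scaleN1r repD repZ scaleN1r. Qed.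

Lemma rep_sum g (I : Type) (r : seq I) (f : I -> H) :
  pi g (\sum_(i <- r) f i) = \sum_(i <- r) pi g (f i).
Proof. by elim/big_rec2: _ => [|i y x _ <-]; rewrite ?rep0 ?repD. Qed.

Lemma norm_rep g x : `|pi g x| = `|x|.
Proof.
have [_ _ iso] := pi_rep.1 g.
by apply/eqP; rewrite -(@eqrXn2 _ 2) // -!Hhilbert iso.
Qed.

(** Multiplicativity makes [pi 1] idempotent, and an injective idempotent is the identity. *)
Lemma rep1 x : pi 1%g x = x.
Proof.
have [_ /bij_inj inj _] := pi_rep.1 1%g.
apply: inj; rewrite -[LHS]/((pi 1%g \o pi 1%g) x).
by rewrite -pi_rep.2 mulg1.
Qed.

Lemma cocycle1 : b 1%g = 0.
Proof.
apply/eqP; rewrite -normr_eq0 -(norm_rep 1%g) normr_eq0.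
by apply/eqP/(addIr (b 1%g)); rewrite -b_cocycle mulg1 add0r.
Qed.

Definition cocycle_lip : R := \sum_(s <- S) `|b s|.

Lemma cocycle_lip_ge0 : 0 <= cocycle_lip.
Proof. exact: sumr_ge0. Qed.

Lemma norm_cocycle g : `|b g| <= cocycle_lip * (wlen S g)%:R.
Proof.
have [s [sS <-] <-] := wlen_word Sgen g.
elim: s sS => [|x s IHs] sS; first by rewrite big_nil cocycle1 normr0 mulr0.
have xS : x \in S by apply: sS; rewrite mem_head.
rewrite big_cons b_cocycle /= -natr1 mulrDr mulr1.
apply: le_trans (ler_normD _ _) _; rewrite norm_rep lerD //.
  by apply: IHs => y ys; apply: sS; rewrite inE ys orbT.
by rewrite /cocycle_lip (big_fsetD1 x) //= lerDl sumr_ge0.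
Qed.

Lemma dot_cocycle_le g xi :
  `|dot (b g) xi| <= cocycle_lip * `|xi| * (wlen S g)%:R.
Proof.
apply: le_trans (dot_le_norm Hhilbert _ _) _.
by rewrite mulrAC ler_wpM2r // norm_cocycle.
Qed.

(** * Weak sublinearity of the cocycle *)

Hypothesis b_weak : forall (xi : H) (mu : nat -> probability (discrete G) R),
  reiter mu ->
  (\int[mu n]_(g in [set: discrete G])
      ((wlen S g)%:R^-1 * dot (b (g : G)^-1%g) xi)%:E)%E
    @[n --> \oo] --> (0 : \bar R)%E.

Variables (F : nat -> {fset G}) (K : R).
Hypotheses (K_gt0 : 0 < K) (FK : controlled_folner S K F).

Lemma dot_cocycle_lt xi eps : 0 < eps ->
  exists M : nat, forall x, (M < wlen S x)%N ->
    dot (b x) xi < eps * (wlen S x)%:R.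
Proof.
move=> eps0; apply: contrapT => noM.
have {}noM (M : nat) : exists x, (M < wlen S x)%N /\
    eps * (wlen S x)%:R <= dot (b x) xi.
  apply: contrapT => nox; apply: noM; exists M => x Mx.
  by rewrite ltNge; apply/negP => le_x; apply: nox; exists x.
pose C := cocycle_lip * `|xi|.
have C0 : 0 <= C by rewrite mulr_ge0 ?cocycle_lip_ge0.
(* With d the diameter of [F n], every g in the translate of [F n] by [x^-1] satisfies
   [|g| <= |x| + d] and [<b(g^-1), xi> >= eps |x| - C d]. The threshold on |x| is what makes the
   latter exceed [eps/2 (|x| + d)]. *)
have xP n : exists x, eps * (wlen S x)%:R <= dot (b x) xi /\
    (diam S (F n))%:R * (2 * C / eps + 1) < (wlen S x)%:R.
  have [x [xM xe]] := noM (Num.truncn ((diam S (F n))%:R * (2 * C / eps + 1))).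
  by exists x; split=> //; apply: lt_le_trans (truncnS_gt _) _; rewrite ler_nat.
have [x {}xP] := choice xP.
pose mu n := unif R (rtransl (F n) (x n)^-1%g).
have mu_reiter : reiter mu by exact/reiter_unif_rtransl/FK.1.
(* The integrals tend to 0, yet each of them will be at least [eps / 2]. *)
suff : ((eps / 2)%:E <= (0 : \bar R))%E by rewrite lee_fin leNgt divr_gt0.
apply: (cvge_to_ge (b_weak xi mu_reiter)); apply: nearW => n.
have [xe xd] := xP n; set d := (diam S (F n))%:R in xd.
have d0 : 0 <= d by [].
apply: unif_integral_ge => [||g]; last 1 first.
- rewrite rtranslP invgK => gF.
  have gd : (wlen S (g * x n)%g)%:R <= d by rewrite ler_nat wlen_diam.
  have xg : (wlen S (x n))%:R <= (wlen S g)%:R + d.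
    apply: le_trans (_ : (wlen S g + wlen S (g * x n)%g)%:R <= _); last first.
      by rewrite natrD lerD2l.
    rewrite ler_nat -[x n in leqLHS](mulKg g).
    by apply: leq_trans (wlenM Sgen _ _) _; rewrite leq_add2r wlenV.
  have gx : (wlen S g)%:R <= d + (wlen S (x n))%:R.
    apply: le_trans (_ : (wlen S (g * x n)%g + wlen S (x n))%:R <= _); last first.
      by rewrite natrD lerD2r.
    rewrite ler_nat -[g in leqLHS](mulgK (x n)).
    by apply: leq_trans (wlenM Sgen _ _) _; rewrite leq_add2l wlenV.
  have Cd : `|dot (pi (x n) (b (g * x n)^-1%g)) xi| <= C * d.
    apply: le_trans (dot_le_norm Hhilbert _ _) _; rewrite norm_rep /C mulrAC.
    rewrite ler_wpM2r //; apply: le_trans (norm_cocycle _) _.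
    rewrite ler_wpM2l ?cocycle_lip_ge0 //; apply: le_trans gd.
    by rewrite ler_nat wlenV.
  have {}xd : d * C + eps / 2 * d < eps / 2 * (wlen S (x n))%:R.
    rewrite -(ltr_pM2l (_ : 0 < 2 / eps)) ?divr_gt0 //.
    rewrite (_ : _ * (eps / 2 * _) = (wlen S (x n))%:R); last first.
      by field; rewrite gt_eqF.
    rewrite (_ : _ * (_ + _) = d * (2 * C / eps + 1)) //.
    by field; rewrite gt_eqF.
  (* The translate avoids the identity, where the weight would be the default [0^-1 = 0]. *)
  have g0 : 0 < (wlen S g)%:R :> R.
    have dC0 : 0 <= d * C by rewrite mulr_ge0.
    rewrite -(ltr_pM2l (_ : 0 < eps / 2)) ?divr_gt0 // mulr0.
    have : eps / 2 * (wlen S (x n))%:R <= eps / 2 * ((wlen S g)%:R + d).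
      by rewrite ler_pM2l ?divr_gt0.
    lra.
  rewrite [leRHS]mulrC ler_pdivlMr //.
  (* This factorization splits [b(g^-1)] into [b (x n)] and an error of pairing at most [C * d],
     since [g * x n] lies in [F n]. *)
  rewrite (_ : (g^-1 = x n * (g * x n)^-1)%g); last by rewrite invgM mulVKg.
  rewrite b_cocycle linearDl /=.
  have : eps / 2 * (wlen S g)%:R <= eps / 2 * (d + (wlen S (x n))%:R).
    by rewrite ler_pM2l ?divr_gt0.
  by move: Cd; rewrite ler_norml => /andP[]; lra.
- by rewrite -cardfs_gt0 card_rtransl cardfs_gt0 FK.1.1.
- by rewrite divr_ge0 ?ltW.
Qed.

(** Applying the one-sided bound to [xi] and [- xi] controls the absolute value far out; the
    constant comes from the Lipschitz bound on the remaining ball. *)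
Lemma dot_cocycle_small xi eps : 0 < eps ->
  exists c : R, forall x, `|dot (b x) xi| <= c + eps * (wlen S x)%:R.
Proof.
move=> eps0.
have [M1 M1P] := dot_cocycle_lt xi eps0.
have [M2 M2P] := dot_cocycle_lt (- xi) eps0.
exists (cocycle_lip * `|xi| * (M1 + M2)%:R) => x.
have eS : 0 <= eps * (wlen S x)%:R by rewrite mulr_ge0 // ltW.
have [xM|Mx] := leqP (wlen S x) (M1 + M2).
  apply: le_trans (dot_cocycle_le _ _) _; apply: ler_wpDr => //.
  by rewrite ler_wpM2l ?ler_nat ?mulr_ge0 ?cocycle_lip_ge0.
rewrite ler_wpDl ?mulr_ge0 ?cocycle_lip_ge0 // ler_norml lerNl -linearNr /=.
by rewrite !ltW ?M1P ?M2P // (leq_ltn_trans _ Mx) ?leq_addr ?leq_addl.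
Qed.

(** * Displacement of the Følner averages *)

Definition defect_ratio (s : G) (n : nat) : R :=
  #|` fsymdiff (ltransl s (F n)) (F n)|%:R / #|` F n|%:R.

Definition avg (n : nat) : H := #|` F n|%:R^-1 *: \sum_(x <- F n) b x.

Definition defect (s : G) (n : nat) : H := pi s (avg n) + b s - avg n.

Lemma defect_ratio_ge0 s n : 0 <= defect_ratio s n.
Proof. by rewrite divr_ge0. Qed.

(** The product form also covers diameter 0, where the control condition is silent. *)
Lemma defect_ratio_diam s n : s \in S ->
  defect_ratio s n * (diam S (F n))%:R <= K.
Proof.
move=> sS; have [->|d0] := posnP (diam S (F n)); first by rewrite mulr0 ltW.
rewrite -ler_pdivlMr ?ltr0n //; apply: le_trans (FK.2 n d0).
rewrite ler_wpM2r ?invr_ge0 // ler_nat fsubset_leq_card //.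
exact: (bigfcup_sup _ sS).
Qed.

Lemma wlen_fsymdiff s n x : s \in S ->
  x \in fsymdiff (ltransl s (F n)) (F n) -> (wlen S x <= diam S (F n) + 1)%N.
Proof.
move=> sS; rewrite fsymdiffP ltranslP => xD.
have [xF|xF] := boolP (x \in F n).
  by apply: leq_trans (wlen_diam S xF) _; rewrite leq_addr.
rewrite (negbTE xF) addbF in xD.
rewrite -(mulVKg s x) addnC; apply: leq_trans (wlenM Sgen _ _) _.
by rewrite leq_add ?wlen_gen ?wlen_diam.
Qed.

(** This is the cocycle identity [b(s x) = pi_s b(x) + b(s)] averaged over x in [F n]. *)
Lemma defectE s n : defect s n = #|` F n|%:R^-1 *:
  (\sum_(x <- ltransl s (F n)) b x - \sum_(x <- F n) b x).
Proof.
rewrite /defect /avg scalerBr; congr (_ - _).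
rewrite repZ rep_sum big_imfset /=; last by move=> x y _ _; exact: mulgI.
have F0 : #|` F n|%:R != 0 :> R by rewrite pnatr_eq0 cardfs_eq0 FK.1.1.
rewrite -[b s in LHS](scalerK F0) -scalerDr; congr (_ *: _).
under [RHS]eq_bigr do rewrite b_cocycle.
rewrite big_split /=; congr (_ + _).
by rewrite big_const_seq count_predT iter_addr_0 scaler_nat.
Qed.

Lemma defect_ratio_cvg0 s : defect_ratio s n @[n --> \oo] --> (0 : R).
Proof. exact: FK.1.2. Qed.

Lemma norm_defect s : s \in S ->
  \forall n \near \oo, `|defect s n| <= cocycle_lip * (K + 1).
Proof.
(* Points of the symmetric difference have length up to diameter plus 1. The diameter contributes
   [K]; the extra 1 contributes the ratio itself, eventually at most 1. *)
move=> sS; have /cvgr0_norm_le/(_ 1 ltr01) := @defect_ratio_cvg0 s.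
apply: filterS => n; rewrite ger0_norm ?defect_ratio_ge0 // => r1.
rewrite defectE.
pose c := cocycle_lip * (diam S (F n) + 1)%:R.
apply: le_trans (norm_ltransl_avg (c := c) _) _.
  move=> x xD; apply: le_trans (norm_cocycle _) _.
  by rewrite ler_wpM2l ?cocycle_lip_ge0 ?ler_nat ?(wlen_fsymdiff sS).
rewrite -/(defect_ratio s n) mulrCA ler_wpM2l ?cocycle_lip_ge0 //.
by rewrite natrD mulrDr mulr1 lerD ?defect_ratio_diam.
Qed.

Lemma dot_defect_cvg0 s xi : s \in S ->
  dot (defect s n) xi @[n --> \oo] --> (0 : R).
Proof.
move=> sS; apply/cvgr0Pnorm_le => eps eps0.
(* The slope [eps / (2 * K)] times ratio times diameter is at most [eps / 2] by the control. The
   other half comes from the constant terms, multiplied by a ratio tending to 0; [|c|] makes the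
   divisor positive. *)
have eK : 0 < eps / (2 * K) by rewrite divr_gt0 ?mulr_gt0.
have [c cP] := dot_cocycle_small xi eK.
have c0 : 0 < `|c| + eps / (2 * K) by rewrite ltr_wpDl.
have /cvgr0_norm_le/(_ (eps / 2 / (`|c| + eps / (2 * K)))) :=
  @defect_ratio_cvg0 s.
rewrite !divr_gt0 // => /(_ isT); apply: filterS => n.
rewrite ger0_norm ?defect_ratio_ge0 // ler_pdivlMr // => r1.
rewrite defectE linearZl linearBl /= !linear_sumlz.
have xD x : x \in fsymdiff (ltransl s (F n)) (F n) ->
    `|dot (b x) xi| <= c + eps / (2 * K) * (diam S (F n) + 1)%:R.
  move=> xD; apply: le_trans (cP x) _.
  by rewrite lerD2l ler_pM2l // ler_nat (wlen_fsymdiff sS).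
apply: le_trans (norm_ltransl_avg (V := R^o) xD) _.
rewrite -/(defect_ratio s n) natrD.
rewrite [leLHS](_ : _ = defect_ratio s n * (c + eps / (2 * K)) +
  eps / (2 * K) * (defect_ratio s n * (diam S (F n))%:R)); last by ring.
have cc : defect_ratio s n * (c + eps / (2 * K)) <=
    defect_ratio s n * (`|c| + eps / (2 * K)).
  by rewrite ler_wpM2l ?defect_ratio_ge0 // lerD2r ler_norm.
have eD : eps / (2 * K) * (defect_ratio s n * (diam S (F n))%:R) <= eps / 2.
  rewrite -[leRHS](_ : eps / (2 * K) * K = _); last by field; rewrite gt_eqF.
  by rewrite ler_pM2l // defect_ratio_diam.
lra.
Qed.

(* Greedy Banach-Saks argument: since [defect s n] is bounded and tends weakly
   to 0, the next [avg n] can be chosen so that the cross term is at most 1,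
   and the squared norm of the accumulated defect grows only linearly. *)
Lemma exists_small_sum N : exists y, forall s, s \in S ->
  `|pi s y - y + N%:R *: b s| ^+ 2 <=
  N%:R * ((cocycle_lip * (K + 1)) ^+ 2 + 2).
Proof.
elim: N => [|N [y yP]].
  by exists 0 => s _; rewrite rep0 scale0r subrr addr0 normr0 mul0r expr0n.
pose w s := pi s y - y + N%:R *: b s.
(* Since [S] is finite, a single n serves all generators at once. *)
have : \forall n \near \oo, forall s : S,
    `|defect (val s) n| <= cocycle_lip * (K + 1) /\
    `|dot (defect (val s) n) (w (val s))| <= 1.
  apply: filter_forall => s; near=> n; split; near: n.
    exact/norm_defect/valP.
  by have /cvgr0_norm_le/(_ 1 ltr01) := dot_defect_cvg0 (w (val s)) (valP s).
move=> [n _ /(_ n (leqnn n)) nP]; exists (y + avg n) => s sS.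
have [/= d1 d2] := nP (FSetSub sS).
rewrite (_ : _ + _ = w s + defect s n); last first.
  rewrite /w /defect repD -natr1 scalerDl scale1r opprD.
  rewrite [X in X + _]addrACA [LHS]addrACA.
  by rewrite [pi s (avg n) - avg n + _]addrAC.
(* The summand 2 of the bound pays for the doubled cross term. *)
rewrite (sqr_normD Hhilbert) -natr1 mulrDl mul1r -addrA lerD ?yP //.
rewrite addrC lerD //; first by rewrite ler_sqr ?nnegrE // (le_trans _ d1).
by rewrite dotC lerMn2r; apply: le_trans (ler_norm _) _.
Unshelve. all: by end_near. Qed.

(** * From the generators to the whole group *)

Lemma gen_almost_fixed_points : exists xi : nat -> H, forall s, s \in S ->
  `|affine_action pi b s (xi n) - xi n| @[n --> \oo] --> (0 : R).
Proof.
have [y yP] := choice exists_small_sum.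
(* Dividing by the number of summands turns a squared norm of linear growth into one of order
   [Q / n.+1]; the shift avoids dividing by zero. *)
exists (fun n => n.+1%:R^-1 *: y n.+1) => s sS.
pose Q := (cocycle_lip * (K + 1)) ^+ 2 + 2.
have Q0 : 0 < Q by rewrite ltr_wpDl // sqr_ge0.
apply/cvgr0Pnorm_le => eps eps0; near=> n.
rewrite normr_id -ler_sqr ?nnegrE ?(ltW eps0) //.
rewrite (_ : _ - _ = n.+1%:R^-1 *: (pi s (y n.+1) - y n.+1 + n.+1%:R *: b s));
    last first.
  rewrite /affine_action repZ scalerDr scalerBr scalerA mulVf ?pnatr_eq0 //.
  by rewrite scale1r addrAC.
rewrite normrZ ger0_norm ?invr_ge0 // exprMn.
apply: (@le_trans _ _ (n.+1%:R^-1 ^+ 2 * (n.+1%:R * Q))).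
  by rewrite ler_wpM2l ?exprn_ge0 ?invr_ge0 // yP.
rewrite mulrA expr2 divfK ?pnatr_eq0 //.
rewrite ler_pdivrMl ?ltr0n // -ler_pdivrMr ?exprn_gt0 //.
near: n; exists (Num.truncn (Q / eps ^+ 2)) => // n /= nQ.
by apply/ltW/(lt_le_trans (truncnS_gt _)); rewrite ler_nat ltnS.
Unshelve. all: by end_near. Qed.

Lemma affine_almost_fixed_points : almost_fixed_points (affine_action pi b).
Proof.
have [xi xiP] := gen_almost_fixed_points; exists xi => g.
have [w [wS <-]] := Sgen g.
elim: w wS => [|s w IHw] wS.
  rewrite big_nil /affine_action cocycle1.
  under eq_fun do rewrite addr0 rep1 subrr normr0.
  exact: cvg_cst.
have sS : s \in S by apply: wS; rewrite mem_head.
have {}IHw := IHw (fun x xw => wS x (@mem_behead _ (s :: w) x xw)).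
apply: (squeeze_cvgr _ (cvg_cst 0)); last first.
  rewrite -[0 : R](addr0 0); exact: cvgD IHw (xiP s sS).
apply: nearW => n; rewrite normr_ge0 big_cons.
(* The displacement under s w is that under w, moved by the isometry [pi s], plus that under s, so
   smallness propagates along words. *)
rewrite (_ : _ - _ =
  pi s (affine_action pi b (\prod_(x <- w) x)%g (xi n) - xi n) +
  (affine_action pi b s (xi n) - xi n)).
  by rewrite (le_trans (ler_normD _ _)) // norm_rep lexx.
rewrite /affine_action pi_rep.2 /= b_cocycle repB repD.
by rewrite -[X in _ = _ + X]addrA [RHS]addrA subrK !addrA.
Qed.

End Cocycle.

Theorem theorem2 (R : realType) (G : groupType) (S : {fset G})
  (Gcountable : countable [set: G])
  (Ssym : symmetric_gen S) (Sgen : generates S)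
  (Gamenable : amenable R G)
  (Gcontrolled : admits_controlled_folner R S)
  (H : completeNormedModType R) (dot : {dot H for idfun})
  (Hhilbert : hilbert_dot dot)
  (pi : G -> H -> H) (pi_rep : orthogonal_rep dot pi)
  (b : G -> H) (b_cocycle : cocycle pi b)
  (b_weak : forall (xi : H) (mu : nat -> probability (discrete G) R),
     reiter mu ->
     (\int[mu n]_(g in [set: discrete G])
        ((wlen S g)%:R^-1 * dot (b (g : G)^-1%g) xi)%:E)%E
       @[n --> \oo] --> (0 : \bar R)%E) :
  almost_fixed_points (affine_action pi b).
Proof.
have [K K0 [F FK]] := Gcontrolled.
exact: (affine_almost_fixed_points Ssym Sgen Hhilbert pi_rep b_cocycle b_weak
  K0 FK).
Qed.
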